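(* Let $(X,\Sigma,\lambda)$ be a positive measure space. A non-zero $f\in L_\infty(X)$ is left-symmetric if and only if there is a $\lambda$-atom $A$ such that $|f(x)|=\|f\|_\infty$ for almost every $x\in A$ and $f(x)=0$ for almost every $x\in X\setminus A$.
   Context: $\mathbb{K}$ is $\mathbb{R}$ or $\mathbb{C}$. $L_\infty(X)=L_\infty^{\mathbb{K}}(X,\Sigma,\lambda)$ is the space of essentially bounded measurable $\mathbb{K}$-valued functions (modulo a.e. equality) with the essential supremum norm $\|\cdot\|_\infty$; the measure is arbitrary (no finiteness or $\sigma$-finiteness is assumed). A set $A\in\Sigma$ is a $\lambda$-atom if $\lambda(A)>0$ and for every $B\in\Sigma$ with $B\subset A$ and $\lambda(B)>0$ one has $\lambda(A\setminus B)=0$ (i.e. $B=A$ up to a null set). In a normed space $\mathbb{X}$ over $\mathbb{K}$, $x\perp_B y$ (Birkhoff-James orthogonality) means $\|x+\alpha y\|\ge\|x\|$ for all $\alpha\in\mathbb{K}$; $x\in\mathbb{X}$ is left-symmetric if $x\perp_B y$ implies $y\perp_B x$ for every $y\in\mathbb{X}$. *)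

(* Defs.v *)
From HB Require Import structures.
From mathcomp Require Import all_boot all_order all_algebra.
From mathcomp Require Import generic_quotient ring_quotient.
From mathcomp Require Import complex.
From mathcomp Require Import all_classical all_reals all_analysis.
From mathcomp Require Import ess_sup_inf measurable_realfun.

Set Implicit Arguments.
Unset Strict Implicit.
Unset Printing Implicit Defensive.

Import Order.TTheory GRing.Theory Num.Theory.
Import numFieldNormedType.Exports.

Local Open Scope classical_set_scope.
Local Open Scope ring_scope.
Local Open Scope quotient_scope.

Section BirkhoffJames.
Variables (K : numFieldType) (V : normedModType K).

Definition birkhoff_orth (x y : V) := forall a : K, `|x| <= `|x + a *: y|.

Definition left_symmetric (x : V) :=
  forall y, birkhoff_orth x y -> birkhoff_orth y x.

End BirkhoffJames.

Definition atom d (T : measurableType d) (R : realType)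
    (mu : {measure set T -> \bar R}) (A : set T) :=
  [/\ measurable A, (0 < mu A)%E &
      forall B, measurable B -> B `<=` A -> (0 < mu B)%E ->
        mu (A `\` B) = 0%E].

(* The scalar field is R or C = R[i], R : realType being the real numbers. *)
Variant scalar_kind := real_scalars | complex_scalars.

Section Scalars.
Variables (R : realType) (k : scalar_kind).

Definition scalar_field : numFieldType :=
  match k with real_scalars => R | complex_scalars => R[i] end.

(* Norms over R[i] take their values in R[i]; scalar_of is the inclusion of R
   in the scalar field and modulus z is the element of R whose image is |z|. *)
Definition scalar_of : R -> scalar_field :=
  match k return R -> match k with
                      | real_scalars => R : numFieldType
                      | complex_scalars => R[i] end with
  | real_scalars => fun r => r
  | complex_scalars => fun r => r%:C%C
  end.

Definition modulus : scalar_field -> R :=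
  match k return match k with
                 | real_scalars => R : numFieldType
                 | complex_scalars => R[i] end -> R with
  | real_scalars => fun z => `|z|
  | complex_scalars => fun z => complex.Re `|z|
  end.

Definition scalar_measurable d (T : measurableType d) :
    (T -> scalar_field) -> Prop :=
  match k return (T -> match k with
                       | real_scalars => R : numFieldType
                       | complex_scalars => R[i] end) -> Prop with
  | real_scalars => fun f => measurable_fun setT (f : T -> R)
  | complex_scalars => fun f => measurable_fun setT (@complex.Re R \o f) /\
                                measurable_fun setT (@complex.Im R \o f)
  end.

End Scalars.

Section ScalarTheory.
Variables (R : realType) (k : scalar_kind).
Local Notation K := (scalar_field R k).
Local Notation iota := (@scalar_of R k).

Lemma scalar_of_modulus (z : K) : iota (modulus z) = `|z|.
Proof. by case: k z => //= z; rewrite normc_def. Qed.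

Lemma ler_scalar_of r s : (iota r <= iota s) = (r <= s).
Proof. by case: k => //=; rewrite lecR. Qed.

Lemma scalar_of_inj : injective iota.
Proof. by case: k => //= r s []. Qed.

Lemma scalar_of0 : iota 0 = 0.
Proof. by case: k. Qed.

Lemma scalar_ofD r s : iota (r + s) = iota r + iota s.
Proof. by case: k => //=; rewrite rmorphD. Qed.

Lemma scalar_ofM r s : iota (r * s) = iota r * iota s.
Proof. by case: k => //=; rewrite rmorphM. Qed.

Lemma modulus_ge0 (z : K) : 0 <= modulus z.
Proof. by rewrite -ler_scalar_of scalar_of_modulus scalar_of0. Qed.

Lemma modulus0 : modulus (0 : K) = 0.
Proof. by apply: scalar_of_inj; rewrite scalar_of_modulus normr0 scalar_of0. Qed.

Lemma modulus_eq0 (z : K) : modulus z = 0 -> z = 0.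
Proof.
by move=> z0; apply/normr0_eq0; rewrite -scalar_of_modulus z0 scalar_of0.
Qed.

Lemma modulusD (z w : K) : modulus (z + w) <= modulus z + modulus w.
Proof. by rewrite -ler_scalar_of scalar_ofD !scalar_of_modulus ler_normD. Qed.

Lemma modulusM (z w : K) : modulus (z * w) = modulus z * modulus w.
Proof. by apply: scalar_of_inj; rewrite scalar_ofM !scalar_of_modulus normrM. Qed.

Lemma scalar_ofV r : iota r^-1 = (iota r)^-1.
Proof. by case: k => //=; rewrite fmorphV. Qed.

Lemma modulusV (z : K) : modulus z^-1 = (modulus z)^-1.
Proof. by apply: scalar_of_inj; rewrite scalar_ofV !scalar_of_modulus normfV. Qed.

Variables (d : measure_display) (T : measurableType d).

Lemma scalar_measurable_cst (c : K) : scalar_measurable (fun _ : T => c).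
Proof. by case: k c => [c|c] /=; [|split]; exact: measurable_cst. Qed.

Lemma scalar_measurableD (f g : T -> K) :
  scalar_measurable f -> scalar_measurable g -> scalar_measurable (f \+ g).
Proof.
case: k f g => f g /=; first exact: measurable_funD.
move=> [mf mf'] [mg mg']; split.
- apply: (eq_measurable_fun ((@complex.Re R \o f) \+ (@complex.Re R \o g))).
    by move=> x _ /=; rewrite raddfD.
  exact: measurable_funD.
- apply: (eq_measurable_fun ((@complex.Im R \o f) \+ (@complex.Im R \o g))).
    by move=> x _ /=; rewrite raddfD.
  exact: measurable_funD.
Qed.

Lemma scalar_measurableM (f g : T -> K) :
  scalar_measurable f -> scalar_measurable g -> scalar_measurable (f \* g).
Proof.
case: k f g => f g /=; first exact: measurable_funM.
move=> [mf mf'] [mg mg']; split.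
- apply: (eq_measurable_fun (((@complex.Re R \o f) \* (@complex.Re R \o g)) \-
                             ((@complex.Im R \o f) \* (@complex.Im R \o g)))).
    by move=> x _ /=; case: (f x) => a b; case: (g x).
  by apply: measurable_funB; exact: measurable_funM.
- apply: (eq_measurable_fun (((@complex.Re R \o f) \* (@complex.Im R \o g)) \+
                             ((@complex.Im R \o f) \* (@complex.Re R \o g)))).
    by move=> x _ /=; case: (f x) => a b; case: (g x).
  by apply: measurable_funD; exact: measurable_funM.
Qed.

End ScalarTheory.

Section Linfty_functions.
Variables (R : realType) (k : scalar_kind).
Variables (d : measure_display) (T : measurableType d).
Variable mu : {measure set T -> \bar R}.
Local Notation K := (scalar_field R k).

Definition Linfty_fun : {pred T -> K} :=
  [pred f | `[< scalar_measurable f /\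
                finite_norm mu +oo%E (@modulus R k \o f) >]].

(* The library's L^oo norm is the essential supremum of |f|, with value 0 when
   the whole space is null. *)
Definition ess_norm (f : T -> K) : R :=
  fine ('N[mu]_+oo[EFin \o (@modulus R k \o f)])%E.

Lemma Linfty_funP (f : T -> K) :
  reflect (scalar_measurable f /\
           exists M : R, \forall x \ae mu, modulus (f x) <= M)
          (f \in Linfty_fun).
Proof.
apply: (iffP (asboolP _)) => -[mf bf]; split=> //; move: bf;
  rewrite /finite_norm unlock /Lnorm.
- case: ifPn => [mu0|].
    case E : (ess_sup _ _) => [r| |]// _.
    + exists r; have := @ess_sup_ge _ _ _ mu (abse \o (EFin \o (@modulus R k \o f))).
      rewrite E; apply: filterS => x /=.
      by rewrite ger0_norm ?modulus_ge0// lee_fin.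
    + exists 0; have := @ess_sup_ge _ _ _ mu (abse \o (EFin \o (@modulus R k \o f))).
      by rewrite E; apply: filterS => x /=.
  rewrite lt0e measure_ge0 andbT negbK => /eqP mu0 _.
  by exists 0; exact: measure0_ae.
- move=> [M fM]; case: ifPn => // mu0; apply: le_lt_trans (ltry M).
  apply/ess_supP; apply: filterS fM => x /=.
  by rewrite ger0_norm ?modulus_ge0// lee_fin.
Qed.

Lemma ess_norm_ge0 f : 0 <= ess_norm f.
Proof. by apply: fine_ge0; exact: Lnorm_ge0. Qed.

Lemma ess_norm_le (f : T -> K) (M : R) : 0 <= M ->
  (\forall x \ae mu, modulus (f x) <= M) -> ess_norm f <= M.
Proof.
move=> M0 fM; rewrite -lee_fin.
have le_N : ('N[mu]_+oo[EFin \o (@modulus R k \o f)] <= M%:E)%E.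
  rewrite unlock /Lnorm; case: ifPn => // _.
  apply/ess_supP; apply: filterS fM => x /=.
  by rewrite ger0_norm ?modulus_ge0// lee_fin.
rewrite fineK// ge0_fin_numE ?Lnorm_ge0//.
exact: le_lt_trans le_N (ltry M).
Qed.

Lemma ess_norm_ge (f : T -> K) : f \in Linfty_fun ->
  \forall x \ae mu, modulus (f x) <= ess_norm f.
Proof.
move=> /asboolP[mf finf].
have [mu0|] := boolP (0 < mu [set: T])%E; last first.
  rewrite lt0e measure_ge0 andbT negbK => /eqP mu0.
  exact: measure0_ae.
have := @ess_sup_ge _ _ _ mu (abse \o (EFin \o (@modulus R k \o f))).
have -> : ess_sup mu (abse \o (EFin \o (@modulus R k \o f))) = (ess_norm f)%:E.
  rewrite /ess_norm fineK ?ge0_fin_numE ?Lnorm_ge0//.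
  by rewrite unlock /Lnorm mu0.
apply: filterS => x /=.
by rewrite ger0_norm ?modulus_ge0// lee_fin.
Qed.

Lemma Linfty_fun_submod : submod_closed Linfty_fun.
Proof.
split=> [|a f g /Linfty_funP[mf [M fM]] /Linfty_funP[mg [N gN]]];
  apply/Linfty_funP; split.
- exact: scalar_measurable_cst.
- by exists 0; apply/nearW => x; rewrite modulus0.
- apply: scalar_measurableD => //; apply: scalar_measurableM => //.
  exact: scalar_measurable_cst.
- exists (modulus a * M + N); apply: filterS2 fM gN => x fx gx.
  apply: le_trans (modulusD _ _) _; rewrite lerD// modulusM.
  by rewrite ler_wpM2l// modulus_ge0.
Qed.

HB.instance Definition _ :=
  GRing.isSubmodClosed.Build K (T -> K) Linfty_fun Linfty_fun_submod.

(* Bounded representatives, before identification of a.e. equal functions. *)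
Record Linfty_rep := LinftyRep {
  Linfty_val :> T -> K;
  Linfty_valP : Linfty_val \in Linfty_fun }.

HB.instance Definition _ := [isSub for Linfty_val].
HB.instance Definition _ := [Choice of Linfty_rep by <:].
HB.instance Definition _ := [SubChoice_isSubLmodule of Linfty_rep by <:].

Definition ae_zero : {pred Linfty_rep} :=
  [pred f : Linfty_rep | `[< \forall x \ae mu, f x = 0 >]].

Lemma ae_zeroP (f : Linfty_rep) :
  reflect (\forall x \ae mu, f x = 0) (f \in ae_zero).
Proof. exact: asboolP. Qed.

Lemma ae_zero_zmod : zmod_closed ae_zero.
Proof.
split; first by apply/ae_zeroP/nearW.
move=> f g /ae_zeroP f0 /ae_zeroP g0; apply/ae_zeroP.
by apply: filterS2 f0 g0 => x /= fx gx; rewrite !fctE /= fx gx subr0.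
Qed.

HB.instance Definition _ :=
  GRing.isZmodClosed.Build Linfty_rep ae_zero ae_zero_zmod.

(* Representatives are identified when their difference vanishes a.e. *)
Definition Linfty := Quotient.quot ae_zero.

HB.instance Definition _ := GRing.Zmodule.on Linfty.
HB.instance Definition _ := EqQuotient.on Linfty.

(* A chosen representative; only its a.e. class is meaningful. *)
Definition Linfty_to_fun (F : Linfty) : T -> K := repr F.
Local Coercion Linfty_to_fun : Linfty >-> Funclass.

Definition Linfty_class (f : Linfty_rep) : Linfty := \pi_Linfty f.

Lemma Linfty_classP (f g : Linfty_rep) :
  Linfty_class f = Linfty_class g <-> \forall x \ae mu, f x = g x.
Proof.
rewrite /Linfty_class (rwP eqP) -Quotient.idealrBE -(rwP (ae_zeroP _)).
split; apply: filterS => x /=; rewrite !fctE.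
- by move/eqP; rewrite subr_eq0 => /eqP.
- by move=> ->; rewrite subrr.
Qed.

Lemma Linfty_classK (F : Linfty) : Linfty_class (repr F) = F.
Proof. exact: reprK. Qed.

Lemma Linfty_class_ae (f : Linfty_rep) : \forall x \ae mu, Linfty_class f x = f x.
Proof. by apply/Linfty_classP; rewrite Linfty_classK. Qed.

Lemma Linfty_eqP (F G : Linfty) : F = G <-> \forall x \ae mu, F x = G x.
Proof. by rewrite -Linfty_classP !Linfty_classK. Qed.

Lemma Linfty_fun_to_fun (F : Linfty) : (F : T -> K) \in Linfty_fun.
Proof. exact: Linfty_valP. Qed.

Lemma Linfty_class0 : Linfty_class 0 = 0.
Proof. by rewrite /Linfty_class piE. Qed.

Lemma Linfty_classD (f g : Linfty_rep) :
  Linfty_class (f + g) = Linfty_class f + Linfty_class g.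
Proof. by rewrite /Linfty_class piE. Qed.

Lemma Linfty0_ae : \forall x \ae mu, (0 : Linfty) x = 0.
Proof. by have := Linfty_class_ae 0; rewrite Linfty_class0. Qed.

Lemma LinftyD_ae (F G : Linfty) : \forall x \ae mu, (F + G : Linfty) x = F x + G x.
Proof.
have := Linfty_class_ae (repr F + repr G).
by rewrite Linfty_classD !Linfty_classK.
Qed.

Definition Linfty_scale (a : K) (F : Linfty) : Linfty :=
  Linfty_class (a *: repr F).

Lemma Linfty_scale_ae a (F : Linfty) :
  \forall x \ae mu, Linfty_scale a F x = a * F x.
Proof. exact: Linfty_class_ae. Qed.

Lemma Linfty_scaleA a b F :
  Linfty_scale a (Linfty_scale b F) = Linfty_scale (a * b) F.
Proof.
apply/Linfty_classP; apply: filterS (Linfty_scale_ae b F) => x /= E.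
rewrite !fctE -scalerA; congr (_ *: _); exact: E.
Qed.

Lemma Linfty_scale1 : left_id 1 Linfty_scale.
Proof. by move=> F; rewrite /Linfty_scale scale1r Linfty_classK. Qed.

Lemma Linfty_scaleDr : right_distributive Linfty_scale +%R.
Proof.
move=> a F G; rewrite -Linfty_classD -scalerDr; apply/Linfty_classP.
by apply: filterS (LinftyD_ae F G) => x E; exact: (congr1 ( *:%R a) E).
Qed.

Lemma Linfty_scaleDl F :
  {morph (fun a => Linfty_scale a F) : a b / a + b}.
Proof. by move=> a b; rewrite -Linfty_classD -scalerDl. Qed.

HB.instance Definition _ := GRing.Zmodule_isLmodule.Build K Linfty
  Linfty_scaleA Linfty_scale1 Linfty_scaleDr Linfty_scaleDl.

Lemma LinftyZ_ae a (F : Linfty) : \forall x \ae mu, (a *: F : Linfty) x = a * F x.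
Proof. exact: Linfty_scale_ae. Qed.

Definition Linfty_norm (F : Linfty) : K := scalar_of k (ess_norm F).

Lemma ler_Linfty_normD (F G : Linfty) :
  Linfty_norm (F + G) <= Linfty_norm F + Linfty_norm G.
Proof.
rewrite /Linfty_norm -scalar_ofD ler_scalar_of.
apply: ess_norm_le; first by rewrite addr_ge0// ess_norm_ge0.
apply: filterS3 (LinftyD_ae F G) (ess_norm_ge (Linfty_fun_to_fun F))
  (ess_norm_ge (Linfty_fun_to_fun G)) => x -> Fx Gx.
by apply: le_trans (modulusD _ _) _; rewrite lerD.
Qed.

Lemma Linfty_normZ a (F : Linfty) : Linfty_norm (a *: F) = `|a| * Linfty_norm F.
Proof.
rewrite /Linfty_norm -scalar_of_modulus -scalar_ofM; congr scalar_of.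
have le_Z b (G : Linfty) : ess_norm (b *: G : Linfty) <= modulus b * ess_norm G.
  apply: ess_norm_le; first by rewrite mulr_ge0 ?modulus_ge0 ?ess_norm_ge0.
  apply: filterS2 (LinftyZ_ae b G) (ess_norm_ge (Linfty_fun_to_fun G)) => x -> Gx.
  by rewrite modulusM ler_wpM2l ?modulus_ge0.
apply/eqP; rewrite eq_le le_Z /=.
have [->|a0] := eqVneq a 0; first by rewrite modulus0 mul0r ess_norm_ge0.
have ma0 : 0 < modulus a.
  rewrite lt_neqAle modulus_ge0 andbT eq_sym.
  by apply: contra a0 => /eqP/modulus_eq0 ->.
rewrite -ler_pdivlMl// -modulusV; apply: le_trans (le_Z _ _).
by rewrite scalerA mulVf// scale1r.
Qed.

Lemma Linfty_norm_eq0 (F : Linfty) : Linfty_norm F = 0 -> F = 0.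
Proof.
rewrite /Linfty_norm -(scalar_of0 R k) => /scalar_of_inj F0.
apply/Linfty_eqP; apply: filterS2 Linfty0_ae (ess_norm_ge (Linfty_fun_to_fun F)).
move=> x ->; rewrite F0 => Fx; apply: modulus_eq0.
by apply/eqP; rewrite eq_le Fx modulus_ge0.
Qed.

HB.instance Definition _ := Lmodule_isNormed.Build K Linfty
  ler_Linfty_normD Linfty_normZ Linfty_norm_eq0.

Lemma Linfty_normE (F : Linfty) : `|F| = scalar_of k (ess_norm F).
Proof. by []. Qed.

End Linfty_functions.

Coercion Linfty_to_fun : Linfty >-> Funclass.

(* Main.v *)
Require Import Defs.
From HB Require Import structures.
From mathcomp Require Import all_boot all_order all_algebra.
From mathcomp Require Import all_classical all_reals all_analysis.
From mathcomp Require Import complex measurable_realfun.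
From mathcomp Require Import ring lra.

(** Write N for the essential supremum norm and |z| for the modulus.

    Suppose that f is left-symmetric.  Cut f along a measurable set B and let g
    be f on B and 0 elsewhere.  If f keeps its full norm outside B, then adding
    multiples of g cannot lower the norm, so f is orthogonal to g.  But g is
    orthogonal to f only if g = 0: subtracting t f from g shrinks g on B by the
    factor 1 - t and costs only t N(f) elsewhere, which is small.  Hence f
    vanishes a.e. on every B outside which it keeps its norm
    ([left_symmetric_vanish]).  Two choices of B conclude.
    - B = {|f| <= r} with r < N(f) shows that |f| takes a.e. only the values 0
      and N(f) ([left_symmetric_modulus]).
    - Now f has full norm on any non-null part of its support.  If the support
      split into two non-null pieces, taking one of them for B would give a
      contradiction, so the support is an atom ([left_symmetric_atom]).

    Conversely, let f live on an atom A with |f| = N(f) there.  Measurable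
    scalar functions are a.e. constant on an atom ([atom_ae_scalar_cst]); let
    c and b be the values of f and g on A.  If b <> 0, then f - t (c / b) g is
    strictly shorter than f for small t > 0, by the same balance as above, so f
    is not orthogonal to g.  Thus f orthogonal to g forces g = 0 on A, and then
    g + a f coincides with g wherever g does not vanish, so that g is
    orthogonal to f ([atom_left_symmetric]). *)

Import Order.TTheory GRing.Theory Num.Theory.
Import numFieldNormedType.Exports.

Local Open Scope classical_set_scope.
Local Open Scope ring_scope.

(** * Atoms and almost everywhere constant functions *)

Section Atoms.
Context {R : realType} {d : measure_display} {T : measurableType d}.
Context {mu : {measure set T -> \bar R}}.

Lemma atom_ae_ex (A : set T) (P : T -> Prop) :
  atom mu A -> (\forall x \ae mu, P x) -> exists2 x, A x & P x.
Proof.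
move=> [mA A_gt0 _] aeP; apply: contrapT => noP.
move: A_gt0; rewrite lt0e => /andP[/eqP + _]; apply.
apply/negligibleP => //; apply: negligibleS aeP => x Ax Px.
by apply: noP; exists x.
Qed.

Lemma atom_ae_dichotomy (A B : set T) : atom mu A -> measurable B ->
  (\forall x \ae mu, A x -> B x) \/ (\forall x \ae mu, A x -> ~ B x).
Proof.
move=> [mA _ atomA] mB; have mAB : measurable (A `&` B) by exact: measurableI.
have [AB0|] := eqVneq (mu (A `&` B)) 0%E.
  right; exists (A `&` B); split=> // x /=.
  by move/not_implyP => -[Ax /contrapT Bx].
rewrite -measure_gt0 => /(atomA _ mAB (@subIsetl _ _ _)) AB0; left.
exists (A `\` (A `&` B)); split=> //; first exact: measurableD.
by move=> x /= /not_implyP[Ax nBx]; split=> // -[].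
Qed.

(** By the dichotomy for level sets, every real r is a.e. on one side of h.
    The constant is the cut between the two sides: each neighbourhood of it
    contains h a.e. on A, and countably many neighbourhoods suffice.  As h may
    be unbounded, the cut is finite only because A is not covered by countably
    many null sets. *)
Lemma atom_ae_cst (A : set T) (h : T -> R) : atom mu A ->
  measurable_fun setT h -> exists c, \forall x \ae mu, A x -> h x = c.
Proof.
move=> atomA mh.
have em r : (\forall x \ae mu, A x -> r <= h x) \/
            (\forall x \ae mu, A x -> h x < r).
  have mle : measurable [set x | r <= h x].
    have := measurable_fun_ler (measurable_cst r) mh.
    by move=> /(_ measurableT [set true]); rewrite setTI; exact.
  have [?|lt_r] := atom_ae_dichotomy _ _ atomA mle; first by left.
  by right; apply: filterS lt_r => x + Ax => /(_ Ax)/negP; rewrite -ltNge.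
pose S : set R := [set r | \forall x \ae mu, A x -> r <= h x].
have ltS r s : S r -> (\forall x \ae mu, A x -> h x < s) -> r < s.
  move=> Sr ltr.
  have [x Ax [rh hs]] := atom_ae_ex _ _ atomA (filterI Sr ltr).
  exact: le_lt_trans (rh Ax) (hs Ax).
have supS : has_sup S.
  split.
  - apply: contrapT => S0.
    have ltn n : \forall x \ae mu, A x -> h x < - n%:R.
      by have [Sn|//] := em (- n%:R); case: S0; exists (- n%:R).
    have [x Ax hx] := atom_ae_ex _ _ atomA (ae_foralln ltn).
    have := hx (Num.truncn `|h x|).+1 Ax.
    have := truncnS_gt `|h x|; have := ler_norm (- h x); rewrite normrN.
    by move=> *; lra.
  - apply: contrapT => S0.
    have len n : \forall x \ae mu, A x -> n%:R <= h x.
      have [//|ltn] := em n%:R; case: S0; exists n%:R => r Sr.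
      exact/ltW/(ltS _ _ Sr ltn).
    have [x Ax hx] := atom_ae_ex _ _ atomA (ae_foralln len).
    have := hx (Num.truncn `|h x|).+1 Ax.
    have := truncnS_gt `|h x|; have := ler_norm (h x).
    by move=> *; lra.
exists (sup S).
have ge n : \forall x \ae mu, A x -> sup S - n.+1%:R^-1 <= h x.
  have n0 : 0 < n.+1%:R^-1 :> R by rewrite invr_gt0.
  have [r Sr ltr] := sup_adherent n0 supS.
  by apply: filterS Sr => x + Ax => /(_ Ax); apply: le_trans; exact: ltW.
have le n : \forall x \ae mu, A x -> h x < sup S + n.+1%:R^-1.
  have [Sn|//] := em (sup S + n.+1%:R^-1).
  have := sup_upper_bound supS Sn; rewrite gerDl leNgt.
  by rewrite invr_gt0 ltr0n.
apply: filterS2 (ae_foralln ge) (ae_foralln le) => x gex lex Ax.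
apply/eqP; rewrite eq_le; apply/andP; split; apply/ler_addgt0Pr => e e0.
- have [n] := ltr_add_invr e0; rewrite add0r => ne.
  by apply/ltW/(lt_le_trans (lex n Ax)); rewrite lerD2l ltW.
- have [n] := ltr_add_invr e0; rewrite add0r => ne.
  by rewrite -lerBlDr; apply: le_trans (gex n Ax); rewrite lerD2l lerN2 ltW.
Qed.

End Atoms.

(** * Measurability and modulus of scalar functions *)

Section ScalarFunctions.
Context {R : realType} {k : scalar_kind}.
Local Notation K := (scalar_field R k).

Lemma modulus_scalar_of (r : R) : 0 <= r -> modulus (scalar_of k r) = r.
Proof.
move=> r0; apply: (@scalar_of_inj R k).
by rewrite scalar_of_modulus ger0_norm // -(scalar_of0 R k) ler_scalar_of.
Qed.

Lemma scalar_of1 : scalar_of k (1 : R) = 1.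
Proof. by case: k. Qed.

Lemma modulusN (z : K) : modulus (- z) = modulus z.
Proof. by apply: (@scalar_of_inj R k); rewrite !scalar_of_modulus normrN. Qed.

Lemma scalar_ofB (r s : R) :
  scalar_of k (r - s) = scalar_of k r - scalar_of k s.
Proof. by apply/eqP; rewrite eq_sym subr_eq -scalar_ofD subrK. Qed.

Context {d : measure_display} {T : measurableType d}.

Lemma scalar_measurable_of (h : T -> R) :
  measurable_fun setT h -> scalar_measurable (fun x => scalar_of k (h x)).
Proof. by case: k => mh //=; split=> //; exact: measurable_cst. Qed.

Lemma measurable_modulus (f : T -> K) :
  scalar_measurable f -> measurable_fun setT (fun x => modulus (f x)).
Proof.
case: k f => f /=; first by move=> mf; apply: measurableT_comp mf.
move=> [mRe mIm].
apply: (eq_measurable_fun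
  (Num.sqrt \o (fun x => complex.Re (f x) ^+ 2 + complex.Im (f x) ^+ 2))).
  by move=> x _ /=; case: (f x).
apply: measurableT_comp.
  by apply: continuous_measurable_fun; exact: sqrt_continuous.
by apply: measurable_funD; apply: measurable_funX.
Qed.

Lemma measurable_modulus_le (f : T -> K) (c : R) :
  scalar_measurable f -> measurable [set x | modulus (f x) <= c].
Proof.
move=> /measurable_modulus mf.
have := measurable_fun_ler mf (measurable_cst c).
by move=> /(_ measurableT [set true]); rewrite setTI; exact.
Qed.

Lemma atom_ae_scalar_cst (mu : {measure set T -> \bar R}) (A : set T)
    (f : T -> K) : atom mu A -> scalar_measurable f ->
  exists c, \forall x \ae mu, A x -> f x = c.
Proof.
move=> atomA; case: k f => f /=; first exact: atom_ae_cst.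
move=> [/(atom_ae_cst _ _ atomA)[a fa] /(atom_ae_cst _ _ atomA)[b fb]].
exists (a +i* b)%C; apply: filterS2 fa fb => x /= fa fb Ax.
by move: (fa Ax) (fb Ax); case: (f x) => ? ? /= -> ->.
Qed.

End ScalarFunctions.

(** * Orthogonality in the space of essentially bounded functions *)

Section Linfty_geometry.
Context {R : realType} {k : scalar_kind}.
Context {d : measure_display} {T : measurableType d}.
Context {mu : {measure set T -> \bar R}}.
Local Notation K := (scalar_field R k).
Local Notation N F := (ess_norm mu (F : Linfty k mu)).
Implicit Types F G : Linfty k mu.

Lemma Linfty_ae_le F : \forall x \ae mu, modulus (F x) <= N F.
Proof. exact: ess_norm_ge (Linfty_fun_to_fun F). Qed.

Lemma Linfty_measurable F : scalar_measurable F.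
Proof. by have /Linfty_funP[] := Linfty_fun_to_fun F. Qed.

Lemma birkhoff_orthE F G :
  birkhoff_orth F G <-> forall a : K, N F <= N (F + a *: G).
Proof.
by split=> FG a; have := FG a; rewrite !Linfty_normE ler_scalar_of.
Qed.

Lemma ess_norm_gt0 F : (0 < N F) = (F != 0).
Proof.
rewrite lt0r ess_norm_ge0 andbT; congr negb; apply/eqP/eqP => [F0|->].
  by apply/normr0_eq0; rewrite Linfty_normE F0 scalar_of0.
by apply: (@scalar_of_inj R k); rewrite -Linfty_normE normr0 scalar_of0.
Qed.

Lemma Linfty_restrict (B : set T) F : measurable B ->
  exists G, \forall x \ae mu, (B x -> G x = F x) /\ (~ B x -> G x = 0).
Proof.
move=> mB; pose g : T -> K := fun x => scalar_of k (\1_B x) * F x.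
have Lg : g \in Linfty_fun mu.
  apply/Linfty_funP; split.
    apply: scalar_measurableM (Linfty_measurable F).
    exact/scalar_measurable_of/measurable_indic.
  exists (N F); apply: filterS (Linfty_ae_le F) => x Fx.
  rewrite /g modulusM modulus_scalar_of // indicE.
  by case: (x \in B); rewrite ?mul1r // mul0r ess_norm_ge0.
exists (Linfty_class (LinftyRep Lg)).
apply: filterS (Linfty_class_ae (LinftyRep Lg)) => x -> /=; rewrite /g indicE.
split=> [/mem_set ->|nBx]; first by rewrite scalar_of1 mul1r.
by rewrite memNset // scalar_of0 mul0r.
Qed.

(** The hypothesis on c says that f has the same norm outside B as on the whole
    space; this is what makes f orthogonal to its restriction to B. *)
Lemma left_symmetric_vanish F (B : set T) : left_symmetric F -> measurable B ->
  (forall c, 0 <= c -> (\forall x \ae mu, ~ B x -> modulus (F x) <= c) ->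
     N F <= c) ->
  \forall x \ae mu, B x -> F x = 0.
Proof.
move=> lsF mB norm_out; have [G GE] := Linfty_restrict B F mB.
have FG : birkhoff_orth F G.
  apply/birkhoff_orthE => a; apply: norm_out; first exact: ess_norm_ge0.
  apply: filterS3 GE (LinftyD_ae F (a *: G))
    (filterI (LinftyZ_ae a G) (Linfty_ae_le (F + a *: G))).
  by move=> x [_ G0] E [E' + Bx]; rewrite E E' (G0 Bx) mulr0 addr0.
have /birkhoff_orthE GF := lsF _ FG.
have [G0|] := eqVneq G 0.
  apply: filterS2 GE (Linfty0_ae k mu) => x [GF' _] G0x Bx.
  by rewrite -GF' // G0.
rewrite -ess_norm_gt0 => G_gt0.
have F_ge0 : 0 <= N F := ess_norm_ge0 _ _.
(* t balances the two bounds: (1 - t) N(G) on B and t N(F) off B are equal. *)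
pose t := N G / (N F + N G).
have t1 : 1 - t = N F / (N F + N G) by rewrite /t; field; lra.
have t_ge0 : 0 <= t by rewrite /t divr_ge0 //; lra.
have t1_ge0 : 0 <= 1 - t by rewrite t1 divr_ge0 //; lra.
have := GF (- scalar_of k t); rewrite leNgt => /negP[].
apply: (@le_lt_trans _ _ ((1 - t) * N G)); last first.
  have : 0 < t by rewrite /t divr_gt0 //; lra.
  by move=> t0; nra.
apply: ess_norm_le; first by rewrite mulr_ge0 // ltW.
apply: filterS3 (filterI GE (Linfty_ae_le F)) (LinftyD_ae G (- scalar_of k t *: F))
  (filterI (LinftyZ_ae (- scalar_of k t) F) (Linfty_ae_le G)).
move=> x [[GF' G0] Fx] E [E' Gx]; rewrite E E' mulNr.
have [Bx|Bx] := pselect (B x).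
  rewrite -GF' // -{1}[G x]mul1r -mulrBl -scalar_of1 -scalar_ofB.
  by rewrite modulusM modulus_scalar_of // ler_wpM2l.
rewrite G0 // sub0r modulusN modulusM modulus_scalar_of //.
have -> : (1 - t) * N G = t * N F by rewrite t1 /t; ring.
by rewrite ler_wpM2l.
Qed.

(** The set where |f| < N(f) need not have full norm outside it, since the norm
    may be only approached; so the sets {|f| <= N(f) - 1/(n+1)} are treated one
    at a time and their countable union is taken at the end. *)
Lemma left_symmetric_modulus F : left_symmetric F ->
  \forall x \ae mu, F x <> 0 -> modulus (F x) = N F.
Proof.
move=> lsF.
have small n :
    \forall x \ae mu, modulus (F x) <= N F - n.+1%:R^-1 -> F x = 0.
  have n0 : 0 < n.+1%:R^-1 :> R by rewrite invr_gt0.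
  apply: (left_symmetric_vanish F [set x | modulus (F x) <= N F - n.+1%:R^-1]).
  - exact: lsF.
  - exact/measurable_modulus_le/Linfty_measurable.
  - move=> c c0 Fc; rewrite leNgt; apply/negP => cF.
    pose m := Num.max c (N F - n.+1%:R^-1).
    have : N F <= m.
      apply: ess_norm_le; first by rewrite le_max c0.
      apply: filterS Fc => x Fc; rewrite le_max.
      have [|/negP small] := boolP (modulus (F x) <= N F - n.+1%:R^-1).
        by rewrite orbT.
      by rewrite Fc.
    by rewrite leNgt gt_max cF gtrBl n0.
apply: filterS2 (ae_foralln small) (Linfty_ae_le F) => x sm Fx F0.
apply/eqP; rewrite eq_le Fx leNgt; apply/negP => /ltr_add_invr[n].
by rewrite -ltrBrDr => /ltW /sm.
Qed.

(** Let B be a non-null part of the support.  As |f| = N(f) on B, the function f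
    keeps its norm outside the rest of the support, hence vanishes on that
    rest, which must be null. *)
Lemma left_symmetric_atom F : F != 0 -> left_symmetric F ->
  atom mu [set x | F x <> 0].
Proof.
move=> F_neq0 lsF.
have mA : measurable [set x | F x <> 0].
  have -> : [set x | F x <> 0] = ~` [set x | modulus (F x) <= 0].
    apply/seteqP; split=> x /=.
      by apply: contra_not => F_le0; apply/modulus_eq0/eqP;
        rewrite eq_le F_le0 modulus_ge0.
    by apply: contra_not => ->; rewrite modulus0.
  exact/measurableC/measurable_modulus_le/Linfty_measurable.
have vanish P : measurable P -> (\forall x \ae mu, P x -> F x = 0) ->
    P `<=` [set x | F x <> 0] -> mu P = 0%E.
  move=> mP P0 PF; apply/negligibleP => //; apply: negligibleS P0 => x Px /=.
  by move=> /(_ Px); exact: PF.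
split=> //.
  rewrite measure_gt0; apply: contra F_neq0 => /eqP A0; apply/eqP/Linfty_eqP.
  have : \forall x \ae mu, F x = 0 by exists [set x | F x <> 0]; split.
  by apply: filterS2 (Linfty0_ae k mu) => x ->.
move=> B mB BA B_gt0; apply: (vanish); [exact: measurableD| |by move=> x []].
apply: left_symmetric_vanish (lsF) _ _; first exact: measurableD.
move=> c c0 Fc; rewrite leNgt; apply/negP => cF.
move: B_gt0; rewrite lt0e => /andP[/eqP + _]; apply; apply: vanish => //.
apply: filterS2 Fc (left_symmetric_modulus _ lsF) => x Fc FN Bx.
have : modulus (F x) <= c by apply: Fc => -[].
by rewrite FN; [rewrite leNgt cF|exact: BA].
Qed.

Lemma atom_left_symmetric F (A : set T) : F != 0 -> atom mu A ->
  (\forall x \ae mu, A x -> modulus (F x) = N F) ->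
  (\forall x \ae mu, ~ A x -> F x = 0) -> left_symmetric F.
Proof.
rewrite -ess_norm_gt0 => F_gt0 atomA FA F0 G /birkhoff_orthE FG.
have [c Fc] := atom_ae_scalar_cst _ _ _ atomA (Linfty_measurable F).
have [b Gb] := atom_ae_scalar_cst _ _ _ atomA (Linfty_measurable G).
have cE : modulus c = N F.
  by have [x Ax [/(_ Ax) <- /(_ Ax)]] := atom_ae_ex _ _ atomA (filterI Fc FA).
(* Once g vanishes on A, the functions g and g + a f agree off A. *)
suff b0 : b = 0.
  apply/birkhoff_orthE => a; apply: ess_norm_le; first exact: ess_norm_ge0.
  apply: filterS3 (filterI Gb F0) (LinftyD_ae G (a *: F))
    (filterI (LinftyZ_ae a F) (Linfty_ae_le (G + a *: F))).
  move=> x [Gx Fx] E [E' +]; rewrite E E'.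
  have [Ax|/Fx ->] := pselect (A x); last by rewrite mulr0 addr0.
  by rewrite (Gx Ax) b0 modulus0 ess_norm_ge0.
apply/eqP/negPn/negP => b_neq0.
have b_gt0 : 0 < modulus b.
  rewrite lt0r modulus_ge0 andbT; apply: contra b_neq0 => /eqP.
  by move/modulus_eq0 ->.
have G_ge0 : 0 <= N G := ess_norm_ge0 _ _.
(* t balances the two bounds: (1 - t) N(F) on A and t (N(F) / |b|) N(G) off A
   are equal. *)
pose t := modulus b / (modulus b + N G).
have t1 : 1 - t = N G / (modulus b + N G) by rewrite /t; field; lra.
have t_ge0 : 0 <= t by rewrite /t divr_ge0 //; lra.
have t1_ge0 : 0 <= 1 - t by rewrite t1 divr_ge0 //; lra.
pose a := - (scalar_of k t * (c / b)).
have := FG a; rewrite leNgt => /negP[].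
apply: (@le_lt_trans _ _ ((1 - t) * N F)); last first.
  have : 0 < t by rewrite /t divr_gt0 //; lra.
  by move=> t0; nra.
apply: ess_norm_le; first by rewrite mulr_ge0 // ltW.
apply: filterS3 (filterI (filterI Fc F0) Gb) (LinftyD_ae F (a *: G))
  (filterI (LinftyZ_ae a G) (Linfty_ae_le G)).
move=> x [[Fx Fx0] Gx] E [E' NG]; rewrite E E' /a mulNr.
have [Ax|Ax] := pselect (A x).
  rewrite Fx // Gx // -mulrA divfK // -{1}[c]mul1r -mulrBl -scalar_of1.
  by rewrite -scalar_ofB modulusM modulus_scalar_of // cE.
rewrite Fx0 // sub0r modulusN 3!modulusM modulusV modulus_scalar_of // cE.
have -> : (1 - t) * N F = t * (N F / modulus b) * N G.
  by rewrite t1 /t; field; lra.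
by rewrite ler_wpM2l // mulr_ge0 // divr_ge0 // ltW.
Qed.

End Linfty_geometry.

Theorem theorem2p3p1 (R : realType) (k : scalar_kind)
    (d : measure_display) (T : measurableType d)
    (mu : {measure set T -> \bar R}) (f : Linfty k mu) (f_neq0 : f != 0) :
  left_symmetric f <->
  exists A : set T,
    [/\ atom mu A,
        (\forall x \ae mu, A x -> `|f x| = `|f|) &
        (\forall x \ae mu, (~` A) x -> f x = 0)].
Proof.
split=> [lsf|[A [atomA fA f0]]].
  exists [set x | f x <> 0]; split; first exact: left_symmetric_atom.
    apply: filterS (left_symmetric_modulus _ lsf) => x fx /fx {}fx.
    by rewrite Linfty_normE -fx scalar_of_modulus.
  by apply: aeW => x /contrapT.
apply: atom_left_symmetric f0 => //; apply: filterS fA => x fx /fx {}fx.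
by apply: (@scalar_of_inj R k); rewrite scalar_of_modulus fx Linfty_normE.
Qed.
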